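(* Let $\Psi^+(t,z)=\sum_{k\ge0}\Psi^+_kz^k$ and $\Psi^-(t,z)=\sum_{k\ge0}\Psi^-_kz^k$ be formal power series in $z$ and $t=(t^1,\dots,t^N)$ with values in complex $N\times N$ matrices such that $\Psi^-(t,-z)\Psi^+(t,z)=\mathrm{id}$ and, for $k=1,\dots,N$, $$\frac{\partial}{\partial t^k}\Psi^+(t,z)=(zE_{kk}+W_k)\Psi^+(t,z),$$ where $E_{kk}$ is the matrix with $1$ as the $k$-th diagonal entry and zeroes elsewhere and $W_k=W_k(t)$ is some matrix that does not depend on $z$. Then the matrices $$M_{a,b}:=(-1)^b\Psi^-_{a+b+1}\Psi^+_0+(-1)^{b-1}\Psi^-_{a+b}\Psi^+_1+\cdots+\Psi^-_{a+1}\Psi^+_b,\qquad a,b\ge0,$$ satisfy the master equations, that is, for all $a,b\ge0$, $M_{a+1,b}+M_{a,b+1}=M_{a,0}M_{0,b}$, $dM_{a+1,b}=M_{a,0}\,dM_{0,b}$, and $dM_{a,b+1}=dM_{a,0}\,M_{0,b}$.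
   Context: The coefficients $\Psi^\pm_k=\Psi^\pm_k(t)$ are matrices of formal power series in $t$, and $d$ is the differential in $t$. (In the paper these series arise from wave functions of multi-component KP hierarchies, but the listed properties are used as axioms.) *)

(* Defs.v *)
From HB Require Import structures.
From mathcomp Require Import all_boot all_order all_algebra.
From mathcomp Require Import complex boolp reals mpoly.

Set Implicit Arguments.
Unset Strict Implicit.
Unset Printing Implicit Defensive.

Import GRing.Theory.
Local Open Scope ring_scope.

(** Formal power series in [n] commuting variables: [tcoef f m] is the
    coefficient of the monomial with exponent vector [m]. *)
Record tseries (n : nat) (R : Type) := TSeries { tcoef : 'X_{1..n} -> R }.

Lemma tseriesP (n : nat) (R : Type) (f g : tseries n R) :
  tcoef f =1 tcoef g -> f = g.
Proof. by case: f g => [f] [g] /= /funext ->. Qed.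

HB.instance Definition _ (n : nat) (R : Type) := gen_eqMixin (tseries n R).
HB.instance Definition _ (n : nat) (R : Type) := gen_choiceMixin (tseries n R).

Section TSeriesRing.
Variables (n : nat) (R : comNzRingType).
Implicit Types f g h : tseries n R.

Definition tzero : tseries n R := TSeries (fun=> 0).
Definition tone : tseries n R := TSeries (fun m => (m == 0%MM)%:R).
Definition topp f : tseries n R := TSeries (fun m => - tcoef f m).
Definition tadd f g : tseries n R := TSeries (fun m => tcoef f m + tcoef g m).

(** Multi-indices that add up to [m] have degree at most [mdeg m], so the sum
    runs over all decompositions of [m]; this mirrors [mcoeffM]. *)
Definition tmul f g : tseries n R :=
  TSeries (fun m =>
    \sum_(k : 'X_{1..n < (mdeg m).+1, (mdeg m).+1} | m == (k.1 + k.2)%MM)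
       tcoef f k.1 * tcoef g k.2).

Fact taddA : associative tadd.
Proof. by move=> f g h; apply: tseriesP => m; rewrite /= addrA. Qed.
Fact taddC : commutative tadd.
Proof. by move=> f g; apply: tseriesP => m; rewrite /= addrC. Qed.
Fact tadd0 : left_id tzero tadd.
Proof. by move=> f; apply: tseriesP => m; rewrite /= add0r. Qed.
Fact taddN : left_inverse tzero topp tadd.
Proof. by move=> f; apply: tseriesP => m; rewrite /= addNr. Qed.

HB.instance Definition _ :=
  GRing.isZmodule.Build (tseries n R) taddA taddC tadd0 taddN.

(** The ring axioms are inherited from [{mpoly R[n]}] by truncation. *)
Let trunc d f : {mpoly R[n]} := \sum_(m : 'X_{1..n < d}) tcoef f m *: 'X_[m].

Let truncE d f m : (mdeg m < d)%N -> (trunc d f)@_m = tcoef f m.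
Proof. exact: mcoeff_mpoly. Qed.

Let tmulE d f g m : (mdeg m < d)%N ->
  tcoef (tmul f g) m = (trunc d f * trunc d g)@_m.
Proof.
move=> lt_md; rewrite mcoeffM; apply: eq_bigr => -[k1 k2] /= _.
by rewrite !truncE // (leq_trans (bmdeg _)).
Qed.

Fact tmulA : associative tmul.
Proof.
move=> f g h; apply: tseriesP => m; pose d := (mdeg m).+1.
transitivity ((trunc d f * trunc d g * trunc d h)@_m).
  rewrite -mulrA mcoeffM; apply: eq_bigr => -[k1 k2] /= _.
  by rewrite truncE ?bmdeg // -tmulE ?bmdeg.
rewrite mcoeffM; apply: eq_bigr => -[k1 k2] /= _.
by rewrite truncE ?bmdeg // -tmulE ?bmdeg.
Qed.

Fact tmulC : commutative tmul.
Proof.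
by move=> f g; apply: tseriesP => m; rewrite !(@tmulE (mdeg m).+1) // mulrC.
Qed.

Fact tmul1 : left_id tone tmul.
Proof.
move=> f; apply: tseriesP => m; rewrite -[RHS](@truncE (mdeg m).+1) //.
rewrite -[trunc _ _]mul1r mcoeffM; apply: eq_bigr => -[k1 k2] /= _.
by rewrite mcoeff1 truncE ?bmdeg.
Qed.

Fact tmulDl : left_distributive tmul tadd.
Proof.
move=> f g h; apply: tseriesP => m; rewrite /= -big_split.
by apply: eq_bigr => k _ /=; rewrite mulrDl.
Qed.

Fact tone_neq0 : tone != 0.
Proof.
apply/eqP => /(congr1 (fun f => tcoef f 0%MM)) /= /eqP.
by rewrite eqxx oner_eq0.
Qed.

HB.instance Definition _ :=
  GRing.Zmodule_isComNzRing.Build (tseries n R) tmulA tmulC tmul1 tmulDl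
    tone_neq0.

Lemma tcoef0 m : tcoef (0 : tseries n R) m = 0. Proof. by []. Qed.
Lemma tcoef1 m : tcoef (1 : tseries n R) m = (m == 0%MM)%:R. Proof. by []. Qed.
Lemma tcoefN f m : tcoef (- f) m = - tcoef f m. Proof. by []. Qed.
Lemma tcoefD f g m : tcoef (f + g) m = tcoef f m + tcoef g m. Proof. by []. Qed.
Lemma tcoefM f g m : tcoef (f * g) m =
  \sum_(k : 'X_{1..n < (mdeg m).+1, (mdeg m).+1} | m == (k.1 + k.2)%MM)
     tcoef f k.1 * tcoef g k.2.
Proof. by []. Qed.

(** Same coefficients as for the polynomial derivative, see [mcoeff_deriv]. *)
Definition tderiv (k : 'I_n) f : tseries n R :=
  TSeries (fun m => tcoef f (m + U_(k))%MM *+ (m k).+1).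

End TSeriesRing.

(** Formal power series in one variable [z] over a ring [A] that is not assumed
    commutative; [z] commutes with the coefficients. *)
Record zseries (A : Type) := ZSeries { zcoef :> nat -> A }.

Lemma zseriesP (A : Type) (f g : zseries A) : f =1 g -> f = g.
Proof. by case: f g => [f] [g] /= /funext ->. Qed.

HB.instance Definition _ (A : Type) := gen_eqMixin (zseries A).
HB.instance Definition _ (A : Type) := gen_choiceMixin (zseries A).

Section ZSeriesRing.
Variable A : pzRingType.
Implicit Types f g h : zseries A.

Definition zzero : zseries A := ZSeries (fun=> 0).
Definition zone : zseries A := ZSeries (fun j => (j == 0)%:R).
Definition zopp f : zseries A := ZSeries (fun j => - f j).
Definition zadd f g : zseries A := ZSeries (fun j => f j + g j).
Definition zmul f g : zseries A :=
  ZSeries (fun j => \sum_(i < j.+1) f i * g (j - i)%N).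

Fact zaddA : associative zadd.
Proof. by move=> f g h; apply: zseriesP => j; rewrite /= addrA. Qed.
Fact zaddC : commutative zadd.
Proof. by move=> f g; apply: zseriesP => j; rewrite /= addrC. Qed.
Fact zadd0 : left_id zzero zadd.
Proof. by move=> f; apply: zseriesP => j; rewrite /= add0r. Qed.
Fact zaddN : left_inverse zzero zopp zadd.
Proof. by move=> f; apply: zseriesP => j; rewrite /= addNr. Qed.

HB.instance Definition _ :=
  GRing.isZmodule.Build (zseries A) zaddA zaddC zadd0 zaddN.

Let zmul_rev f g j : zmul f g j = \sum_(i < j.+1) f (j - i)%N * g i.
Proof.
rewrite /= (reindex_inj rev_ord_inj) /=.
by apply: eq_bigr => i _; rewrite (sub_ordK i).
Qed.

Fact zmulA : associative zmul.
Proof.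
move=> f g h; apply: zseriesP => i; rewrite [RHS]zmul_rev /=.
pose coef3 j k := f j * (g (i - j - k)%N * h k).
transitivity (\sum_(j < i.+1) \sum_(k < i.+1 | (k <= i - j)%N) coef3 j k).
  apply: eq_bigr => /= j _; have /= -> := zmul_rev g h (i - j)%N.
  by rewrite big_distrr /= (big_ord_narrow_leq (leq_subr _ _)).
rewrite (exchange_big_dep predT) //=; apply: eq_bigr => k _.
transitivity (\sum_(j < i.+1 | (j <= i - k)%N) coef3 j k).
  apply: eq_bigl => j; rewrite -ltnS -(ltnS j) -!subSn ?leq_ord //.
  by rewrite -subn_gt0 -(subn_gt0 j) -!subnDA addnC.
rewrite (big_ord_narrow_leq (leq_subr _ _)) big_distrl /=.
by apply: eq_bigr => j _; rewrite /coef3 -!subnDA addnC mulrA.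
Qed.

Fact zmul1l : left_id zone zmul.
Proof.
move=> f; apply: zseriesP => j; rewrite /= big_ord_recl /= subn0 mul1r.
by rewrite big1 ?addr0 // => i _; rewrite mul0r.
Qed.

Fact zmul1r : right_id zone zmul.
Proof.
move=> f; apply: zseriesP => j; rewrite zmul_rev big_ord_recl /= subn0 mulr1.
by rewrite big1 ?addr0 // => i _; rewrite mulr0.
Qed.

Fact zmulDl : left_distributive zmul zadd.
Proof.
move=> f g h; apply: zseriesP => j; rewrite /= -big_split.
by apply: eq_bigr => i _ /=; rewrite mulrDl.
Qed.

Fact zmulDr : right_distributive zmul zadd.
Proof.
move=> f g h; apply: zseriesP => j; rewrite /= -big_split.
by apply: eq_bigr => i _ /=; rewrite mulrDr.
Qed.

HB.instance Definition _ :=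
  GRing.Zmodule_isPzRing.Build (zseries A) zmulA zmul1l zmul1r zmulDl zmulDr.

Lemma zcoef0 j : (0 : zseries A) j = 0. Proof. by []. Qed.
Lemma zcoef1 j : (1 : zseries A) j = (j == 0)%:R. Proof. by []. Qed.
Lemma zcoefN f j : (- f) j = - f j. Proof. by []. Qed.
Lemma zcoefD f g j : (f + g) j = f j + g j. Proof. by []. Qed.
Lemma zcoefM f g j : (f * g) j = \sum_(i < j.+1) f i * g (j - i)%N.
Proof. by []. Qed.

Definition zconst (a : A) : zseries A :=
  ZSeries (fun j => if j is 0%N then a else 0).

Definition zvar : zseries A := ZSeries (fun j => (j == 1)%:R).

(** The substitution [z |-> - z]. *)
Definition zflip f : zseries A := ZSeries (fun j => (-1) ^+ j * f j).

End ZSeriesRing.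

Arguments zvar {A}.

Section Differential.
Variables (n : nat) (R : comNzRingType).

Definition mxtderiv (p q : nat) (k : 'I_n) (A : 'M[tseries n R]_(p, q)) :
  'M[tseries n R]_(p, q) := map_mx (tderiv k) A.

(** Matrix-valued differential 1-forms in [t], given by their components with
    respect to the basis [dt^1, ..., dt^n]. *)
Definition mxform (p q : nat) := {ffun 'I_n -> 'M[tseries n R]_(p, q)}.

Definition mxd (p q : nat) (A : 'M[tseries n R]_(p, q)) : mxform p q :=
  [ffun k => mxtderiv k A].

Definition mulmxform (p q r : nat) (A : 'M[tseries n R]_(p, q))
  (w : mxform q r) : mxform p r := [ffun k => A *m w k].

Definition mulformmx (p q r : nat) (w : mxform p q)
  (A : 'M[tseries n R]_(q, r)) : mxform p r := [ffun k => w k *m A].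

Definition ztderiv (p q : nat) (k : 'I_n)
  (f : zseries 'M[tseries n R]_(p, q)) : zseries 'M[tseries n R]_(p, q) :=
  ZSeries (fun j => mxtderiv k (f j)).

End Differential.

Definition master_solution (n : nat) (R : comNzRingType) (N : nat)
    (M : nat -> nat -> 'M[tseries n R]_N) : Prop :=
  forall a b : nat,
    [/\ M a.+1 b + M a b.+1 = M a 0%N *m M 0%N b,
        mxd (M a.+1 b) = mulmxform (M a 0%N) (mxd (M 0%N b))
      & mxd (M a b.+1) = mulformmx (mxd (M a 0%N)) (M 0%N b)].

(** The truncated subtractions are exact since [i <= b]. *)
Definition wave_master_mx (S : pzRingType) (N : nat)
    (Psim Psip : zseries 'M[S]_N) (a b : nat) : 'M[S]_N :=
  \sum_(i < b.+1)
     (-1) ^+ (b - i) *: (Psim (a + b + 1 - i)%N *m Psip i).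

(* Main.v *)
Require Import Defs.
From mathcomp Require Import all_boot all_order all_algebra.
From mathcomp Require Import complex reals.
From mathcomp Require Import mpoly.

Set Implicit Arguments.
Unset Strict Implicit.
Unset Printing Implicit Defensive.

Import GRing.Theory.
Local Open Scope ring_scope.

(** Write [f] for [Psi^-], [g] for [Psi^+] and a prime for the derivative in
    [t^k].  Then [M] is the table of coefficients of the quotient
    [(f(x) g(y) - 1) / (x + y)], so [M (a+1) b + M a (b+1)] telescopes to the
    single coefficient [f_(a+1) g_(b+1)] of [f(x) g(y)].  On the two edges of
    the table even [M] itself is such a product: [M a 0 = f_(a+1) g_0] by
    definition, and [M 0 b = f_0 g_(b+1)] because all terms of degree [b + 1] in
    [f(-z) g(z) = 1] add up to zero.  Since [g_0 f_0 = 1], the product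
    [M a 0 * M 0 b] collapses to [f_(a+1) g_(b+1)], which is the first master
    equation.

    For the differential equations, put [L(z) = z E + W].  Differentiating
    [f(-z) g(z) = 1] turns [g(z)' = L(z) g(z)] into [f(-z)' = - f(-z) L(z)], so
    in the derivative of [f(x) g(y)] the two occurrences of [W] cancel and
    [(x + y) f(x) E g(y)] is left.  Dividing by [x + y], the derivative of
    [M a b] is [f_a E g_b] ([mxtderiv_wave_master]), and once more
    [g_0 f_0 = 1] gives the factorisations asked for
    ([master_solution_factor]). *)

(** * Differentiation of power series in t *)

Lemma tderiv0 (n : nat) (R : comNzRingType) (k : 'I_n) :
  tderiv k (0 : tseries n R) = 0.
Proof. by apply: tseriesP => m; rewrite /= mul0rn. Qed.

Lemma tderivD (n : nat) (R : comNzRingType) (k : 'I_n) :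
  {morph tderiv (R := R) k : f g / f + g}.
Proof. by move=> f g; apply: tseriesP => m; rewrite /= mulrnDl. Qed.

(** Keeping only the monomials of degree less than [d] gives a genuine
    polynomial, so that coefficientwise identities between series can be read
    off from the ring and derivation structure of [{mpoly R[n]}]. *)
Definition ttrunc (n : nat) (R : comNzRingType) (d : nat) (f : tseries n R) :
    {mpoly R[n]} :=
  \sum_(m : 'X_{1..n < d}) tcoef f m *: 'X_[m].

Lemma mcoeff_ttrunc (n : nat) (R : comNzRingType) d (f : tseries n R) m :
  (mdeg m < d)%N -> (ttrunc d f)@_m = tcoef f m.
Proof. exact: mcoeff_mpoly. Qed.

(** A coefficient of a product of series only sees coefficients of at most the
    same degree, so it can be computed with any polynomials that agree with the
    factors that far. *)
Lemma tcoefM_mpoly (n : nat) (R : comNzRingType) (f g : tseries n R)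
    (p q : {mpoly R[n]}) m :
  (forall j, (mdeg j <= mdeg m)%N -> p@_j = tcoef f j) ->
  (forall j, (mdeg j <= mdeg m)%N -> q@_j = tcoef g j) ->
  tcoef (f * g) m = (p * q)@_m.
Proof.
move=> Ep Eq; rewrite tcoefM mcoeffM; apply: eq_bigr => -[k1 k2] /= _.
by rewrite Ep ?Eq // -ltnS bmdeg.
Qed.

(** The Leibniz rule, transported from polynomials.  Since [tderiv] lowers the
    degree by one, the truncation has to keep one degree more than [m]. *)
Lemma tderivM (n : nat) (R : comNzRingType) (k : 'I_n) (f g : tseries n R) :
  tderiv k (f * g) = tderiv k f * g + f * tderiv k g.
Proof.
apply: tseriesP => m; pose d := (mdeg m).+2.
have degU j : (mdeg j <= mdeg m)%N -> (mdeg (j + U_(k))%MM < d)%N.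
  by rewrite mdegD mdeg1 addn1.
have Et (h : tseries n R) j : (mdeg j <= mdeg m)%N ->
    (ttrunc d h)@_j = tcoef h j.
  by move=> le_jm; rewrite mcoeff_ttrunc // ltnS leqW.
have Ed (h : tseries n R) j : (mdeg j <= mdeg m)%N ->
    (ttrunc d h)^`M(k)@_j = tcoef (tderiv k h) j.
  by move=> le_jm; rewrite mcoeff_deriv mcoeff_ttrunc ?degU.
rewrite tcoefD (tcoefM_mpoly (Ed f) (Et g)) (tcoefM_mpoly (Et f) (Ed g)).
rewrite -mcoeffD -mderivM mcoeff_deriv /=; congr (_ *+ _).
apply: (@tcoefM_mpoly _ _ f g) => j le_jm; rewrite mcoeff_ttrunc //;
  exact: leq_ltn_trans le_jm (degU _ _).
Qed.

Lemma mxtderivD (n : nat) (R : comNzRingType) (p q : nat) (k : 'I_n) :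
  {morph @mxtderiv n R p q k : A B / A + B}.
Proof. by move=> A B; apply/matrixP => i j; rewrite !mxE tderivD. Qed.

Lemma mxtderiv0 (n : nat) (R : comNzRingType) (p q : nat) (k : 'I_n) :
  mxtderiv k (0 : 'M[tseries n R]_(p, q)) = 0.
Proof. by apply/matrixP => i j; rewrite !mxE tderiv0. Qed.

Lemma mxtderivN (n : nat) (R : comNzRingType) (p q : nat) (k : 'I_n) :
  {morph @mxtderiv n R p q k : A / - A}.
Proof.
by move=> A; apply/eqP; rewrite -addr_eq0 -mxtderivD addNr mxtderiv0.
Qed.

Lemma mxtderiv_sign (n : nat) (R : comNzRingType) (p : nat) (k : 'I_n) j
    (A : 'M[tseries n R]_p) :
  mxtderiv k ((-1) ^+ j * A) = (-1) ^+ j * mxtderiv k A.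
Proof.
by rewrite -signr_odd !mulr_sign; case: (odd j); rewrite ?mxtderivN.
Qed.

Lemma mxtderivM (n : nat) (R : comNzRingType) (p q r : nat) (k : 'I_n)
    (A : 'M[tseries n R]_(p, q)) (B : 'M[tseries n R]_(q, r)) :
  mxtderiv k (A *m B) = mxtderiv k A *m B + A *m mxtderiv k B.
Proof.
apply/matrixP => i j; rewrite !mxE (big_morph _ (tderivD k) (tderiv0 _ k)).
by rewrite -big_split; apply: eq_bigr => l _; rewrite /= tderivM !mxE.
Qed.

Lemma ztderivM (n : nat) (R : comNzRingType) (p : nat) (k : 'I_n)
    (f g : zseries 'M[tseries n R]_p) :
  ztderiv k (f * g) = ztderiv k f * g + f * ztderiv k g.
Proof.
apply: zseriesP => j.
rewrite zcoefD !zcoefM /= (big_morph _ (mxtderivD k) (mxtderiv0 _ _ _ k)).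
by rewrite -big_split; apply: eq_bigr => i _; apply: mxtderivM.
Qed.

(** * Inverses of power series in z *)

(** If [f] had a first nonzero coefficient, its product with the constant term
    of [g], nonzero because that term is right invertible, would be the first
    nonzero coefficient of [f * g]. *)
Lemma zmulr_eq0 (A : pzRingType) (f g : zseries A) (u : A) :
  g 0%N * u = 1 -> f * g = 0 -> f = 0.
Proof.
move=> gu1 fg0; apply: zseriesP => j; rewrite zcoef0.
elim/ltn_ind: j => j IHj.
have: (f * g) j = 0 by rewrite fg0.
rewrite zcoefM big_ord_recr big1 /= ?add0r ?subnn => [fjg0|i _].
  by rewrite -[f j]mulr1 -gu1 mulrA fjg0 mul0r.
by rewrite IHj ?mul0r.
Qed.

(** One-sided inverses need not be two-sided over a general ring; here
    [(g f - 1) g = g (f g) - g = 0], and [g] cancels because its constant term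
    is right invertible. *)
Lemma zmul1C (A : pzRingType) (f g : zseries A) :
  g 0%N * f 0%N = 1 -> f * g = 1 -> g * f = 1.
Proof.
move=> gf0 fg1; apply/eqP; rewrite -subr_eq0; apply/eqP.
by apply: (zmulr_eq0 gf0); rewrite mulrBl -mulrA fg1 mulr1 mul1r subrr.
Qed.

(** For square matrices over a commutative ring the constant terms are
    two-sided inverses of each other, hence so are the series. *)
Lemma zmxmul1C (S : comNzRingType) (N : nat) (f g : zseries 'M[S]_N) :
  f * g = 1 -> g * f = 1.
Proof.
move=> fg1; apply: zmul1C => //; apply: mulmx1C.
have: (f * g) 0%N = 1 by rewrite fg1.
by rewrite zcoefM big_ord1 subnn.
Qed.

Lemma zlinearE (A : pzRingType) (E W : A) (j : nat) :
  (zvar * zconst E + zconst W) j = [:: W; E]`_j.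
Proof.
rewrite zcoefD zcoefM; case: j => [|j].
  by rewrite big_ord1 mul0r add0r.
rewrite 2!big_ord_recl big1 /= ?mul0r ?mul1r ?add0r ?addr0 => [|i _].
  by case: j => //= j; rewrite nth_nil.
by rewrite mul0r.
Qed.

Lemma zlinear_mul (A : pzRingType) (E W : A) (f : zseries A) (j : nat) :
  ((zvar * zconst E + zconst W) * f) j =
    (if j is i.+1 then E * f i else 0) + W * f j.
Proof.
rewrite zcoefM; under eq_bigr do rewrite zlinearE.
rewrite big_ord_recl /= subn0 addrC; congr (_ + _).
case: j => [|j]; first by rewrite big_ord0.
rewrite big_ord_recl big1 /= ?subn1 ?addr0 // => i _.
by rewrite nth_nil mul0r.
Qed.

Lemma mul_zlinear (A : pzRingType) (E W : A) (f : zseries A) (j : nat) :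
  (f * (zvar * zconst E + zconst W)) j =
    (if j is i.+1 then f i * E else 0) + f j * W.
Proof.
rewrite zcoefM; under eq_bigr do rewrite zlinearE.
rewrite big_ord_recr /= subnn; congr (_ + _).
case: j => [|j]; first by rewrite big_ord0.
rewrite big_ord_recr /= subSnn big1 ?add0r //= => i _.
by rewrite !subSn ?(ltnW (ltn_ord i)) //= -subnSK //= nth_nil mulr0.
Qed.

(** * The wave function and the adjoint wave function *)

Lemma ztderiv1 (n : nat) (R : comNzRingType) (p : nat) (k : 'I_n) :
  ztderiv k (1 : zseries 'M[tseries n R]_p) = 0.
Proof.
have := @ztderivM n R p k 1 1.
by rewrite !mulr1 mul1r => /eqP; rewrite -subr_eq subrr eq_sym => /eqP.
Qed.

(** The logarithmic derivative of an inverse: differentiate [f g = 1] and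
    multiply by [f], which inverts [g] from the right as well. *)
Lemma ztderiv_inv (n : nat) (R : comNzRingType) (p : nat) (k : 'I_n)
    (f g L : zseries 'M[tseries n R]_p) :
  f * g = 1 -> ztderiv k g = L * g -> ztderiv k f = - (f * L).
Proof.
move=> fg1 Dg; have gf1 := zmxmul1C fg1.
have: ztderiv k (f * g) * f = 0 by rewrite fg1 ztderiv1 mul0r.
rewrite ztderivM Dg mulrDl -!mulrA gf1 !mulr1.
by move/eqP; rewrite addr_eq0 => /eqP.
Qed.

(** The adjoint system [f(-z)' = - f(-z) (z E + W)], coefficient by
    coefficient.  The substitution [z |-> -z] makes the sign of the [E] term
    opposite to that of the [W] term. *)
Lemma mxtderiv_adjoint (n : nat) (R : comNzRingType) (p : nat) (k : 'I_n)
    (f g : zseries 'M[tseries n R]_p) (E W : 'M[tseries n R]_p) (j : nat) :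
  zflip f * g = 1 ->
  ztderiv k g = (zvar * zconst E + zconst W) * g ->
  mxtderiv k (f j) = (if j is i.+1 then f i * E else 0) - f j * W.
Proof.
move=> fg1 Dg; have := ztderiv_inv fg1 Dg.
move/(congr1 (fun h => (-1) ^+ j * zcoef h j)).
rewrite zcoefN mul_zlinear /= mxtderiv_sign signrMK => ->.
rewrite mulrN mulrDr -mulrA signrMK opprD; congr (_ - _).
case: j => [|j]; first by rewrite mulr0 oppr0.
by rewrite exprS mulN1r mulNr opprK -mulrA signrMK.
Qed.

(** * The master matrices *)

(** Both sums run over the same products [f_(a+b+2-i) g_i] with opposite signs,
    except for the extra term [i = b + 1] of the second one. *)
Lemma wave_master_mxS (S : pzRingType) (N : nat)
    (f g : zseries 'M[S]_N) (a b : nat) :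
  wave_master_mx f g a.+1 b + wave_master_mx f g a b.+1 = f a.+1 * g b.+1.
Proof.
rewrite /wave_master_mx [X in _ + X]big_ord_recr /= subnn scale1r addrA.
rewrite -big_split big1 /= => [|i _].
  by rewrite add0r addn1 addnS -addSn subSS addnK.
by rewrite subSn ?leq_ord // exprS mulN1r scaleNr addSnnS subrr.
Qed.

Lemma wave_master_mx_a0 (S : pzRingType) (N : nat)
    (f g : zseries 'M[S]_N) (a : nat) :
  wave_master_mx f g a 0 = f a.+1 * g 0%N.
Proof.
by rewrite /wave_master_mx big_ord1 subnn scale1r subn0 addn0 addn1.
Qed.

(** [M 0 b] consists of all terms but one of the coefficient of [z^(b+1)] in
    [f(-z) g(z) = 1], which vanishes; the missing term is [f_0 g_(b+1)]. *)
Lemma wave_master_mx_0b (S : pzRingType) (N : nat)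
    (f g : zseries 'M[S]_N) (b : nat) :
  zflip f * g = 1 -> wave_master_mx f g 0 b = f 0%N * g b.+1.
Proof.
move/(congr1 (fun h => zcoef h b.+1)); rewrite zcoefM zcoef1 /=.
rewrite big_ord_recl /= mul1r subn0 (reindex_inj rev_ord_inj) /=.
move/eqP; rewrite addr_eq0 => /eqP ->; rewrite -sumrN.
(* After the reversal of the sum, term [i] is [(-1)^(b+1-i) f_(b+1-i) g_i]. *)
apply: eq_bigr => i _; have le_ib := leq_ord i.
rewrite /bump /= add1n !subSS subKn // add0n addn1 subSn //.
rewrite exprS mulN1r !mulNr opprK -mulrA.
by rewrite -signr_odd scaler_sign -signr_odd mulr_sign.
Qed.

(** Induction on [b] through the telescoping relation [wave_master_mxS] replaces
    the summation: the [W] terms of [(f_(a+1) g_(b+1))'] cancel, and what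
    remains is [f_a E g_(b+1) + f_(a+1) E g_b], the last term being the
    derivative of [M (a+1) b]. *)
Lemma mxtderiv_wave_master (n : nat) (R : comNzRingType) (N : nat) (k : 'I_n)
    (f g : zseries 'M[tseries n R]_N) (E W : 'M[tseries n R]_N) (a b : nat) :
  zflip f * g = 1 ->
  ztderiv k g = (zvar * zconst E + zconst W) * g ->
  mxtderiv k (wave_master_mx f g a b) = f a * E * g b.
Proof.
move=> fg1 Dg.
have Df j := mxtderiv_adjoint j fg1 Dg.
have {}Dg j : mxtderiv k (g j) = (if j is i.+1 then E * g i else 0) + W * g j.
  by rewrite -zlinear_mul -Dg.
have DM p q : mxtderiv k (f p.+1 * g q) =
    f p * E * g q + f p.+1 * (if q is i.+1 then E * g i else 0).
  rewrite mxtderivM !mulmxE Df Dg mulrBl mulrDr -!mulrA.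
  by rewrite addrACA addNr addr0.
elim: b a => [|b IHb] a.
  by rewrite wave_master_mx_a0 DM mulr0 addr0.
have := wave_master_mxS f g a b => /(congr1 (mxtderiv k)).
rewrite mxtderivD IHb DM mulrA addrC; exact: addIr.
Qed.

Lemma mxdE (n : nat) (R : comNzRingType) (p q : nat)
    (A : 'M[tseries n R]_(p, q)) (k : 'I_n) :
  mxd A k = mxtderiv k A.
Proof. by rewrite /mxd ffunE. Qed.

Lemma mulmxformE (n : nat) (R : comNzRingType) (p q r : nat)
    (A : 'M[tseries n R]_(p, q)) (w : mxform n R q r) (k : 'I_n) :
  mulmxform A w k = A *m w k.
Proof. by rewrite /mulmxform ffunE. Qed.

Lemma mulformmxE (n : nat) (R : comNzRingType) (p q r : nat)
    (w : mxform n R p q) (A : 'M[tseries n R]_(q, r)) (k : 'I_n) :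
  mulformmx w A k = w k *m A.
Proof. by rewrite /mulformmx ffunE. Qed.

(** An edge entry [M a 0] ends with [g_0], while [M 0 b] and its derivatives
    begin with [f_0]; so in [M a 0 * M 0 b] and [M a 0 * d(M 0 b)] the inner
    factor [g_0 f_0] disappears, and likewise in [d(M a 0) * M 0 b]. *)
Lemma master_solution_factor (n : nat) (R : comNzRingType) (N : nat)
    (M : nat -> nat -> 'M[tseries n R]_N) (f g : nat -> 'M[tseries n R]_N)
    (E : 'I_n -> 'M[tseries n R]_N) :
  g 0%N * f 0%N = 1 ->
  (forall a, M a 0%N = f a.+1 * g 0%N) ->
  (forall b, M 0%N b = f 0%N * g b.+1) ->
  (forall a b, M a.+1 b + M a b.+1 = f a.+1 * g b.+1) ->
  (forall k a b, mxtderiv k (M a b) = f a * E k * g b) ->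
  master_solution M.
Proof.
move=> gf0 Ma0 M0b MS DM a b.
have gf0K x y : x * g 0%N * (f 0%N * y) = x * y.
  by rewrite mulrA -(mulrA x) gf0 mulr1.
split.
- by rewrite MS Ma0 M0b mulmxE gf0K.
- apply/ffunP => k.
  by rewrite mulmxformE !mxdE !DM Ma0 mulmxE -(mulrA (f 0%N)) gf0K mulrA.
- apply/ffunP => k.
  by rewrite mulformmxE !mxdE !DM M0b mulmxE gf0K.
Qed.

Theorem theorem6p1 (R : realType) (N : nat)
    (Psip Psim : zseries 'M[tseries N R[i]]_N)
    (W : 'I_N -> 'M[tseries N R[i]]_N)
    (Psi_inv : zflip Psim * Psip = 1)
    (Psi_deriv : forall k : 'I_N,
       ztderiv k Psip
       = (zvar * zconst (delta_mx k k) + zconst (W k)) * Psip) :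
  master_solution (wave_master_mx Psim Psip).
Proof.
apply: (@master_solution_factor _ _ _ _ Psim Psip (fun k => delta_mx k k)).
- have := congr1 (fun h => zcoef h 0%N) (zmxmul1C Psi_inv).
  by rewrite zcoefM big_ord1 /= mul1r.
- by move=> a; apply: wave_master_mx_a0.
- by move=> b; apply: wave_master_mx_0b.
- by move=> a b; apply: wave_master_mxS.
- by move=> k a b; apply: mxtderiv_wave_master (Psi_deriv k).
Qed.
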